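(* Given any finite abelian group $G$, there is some $n$ and some arithmetical structure $(\mathbf{d},\mathbf{r})$ on the complete graph $K_n$ such that $G\leq \mathcal{K}(K_n; \mathbf{d}, \mathbf{r})$, i.e. $G$ is isomorphic to a subgroup of $\mathcal{K}(K_n; \mathbf{d}, \mathbf{r})$.
   Context: An arithmetical structure on a finite, connected, loopless graph $H$ with vertex set $V(H)$ is a pair $(\mathbf{d},\mathbf{r})$, where $\mathbf{r}=(r_v)_{v\in V(H)}$ consists of positive integers with no common factor, $\mathbf{d}=(d_v)_{v\in V(H)}$ consists of nonnegative integers, and for every vertex $v$ we have $r_vd_v=\sum r_u$, the sum being over all $u$ adjacent to $v$ (with multiplicity for multigraphs). Its critical group $\mathcal{K}(H;\mathbf{d},\mathbf{r})$ is the torsion part of the cokernel (over $\mathbb{Z}$) of the matrix $\operatorname{diag}(\mathbf{d})-A(H)$, where $A(H)$ is the adjacency matrix of $H$. $K_n$ denotes the (simple) complete graph on $n$ vertices. *)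

(* Defs.v *)
From HB Require Import structures.
From mathcomp Require Import all_boot all_order all_algebra.
From mathcomp Require Import boolp.

Set Implicit Arguments.
Unset Strict Implicit.
Unset Printing Implicit Defensive.

Import GRing.Theory.

Local Open Scope ring_scope.

(* Finite, connected, loopless multigraphs on the vertex set 'I_n, given by
   their adjacency matrix: [adj u v] is the number of edges between u and v. *)
Record multigraph (n : nat) := Multigraph {
  adj :> 'M[nat]_n;
  adj_sym : forall u v, adj u v = adj v u;
  adj_loopless : forall v, adj v v = 0%N;
  adj_connected : forall u v, connect (fun x y => (0 < adj x y)%N) u v
}.

(* The empty graph (n = 0) carries no arithmetical structure: an empty gcd is
   0, so [arith_coprime] forces n > 0. *)
Record arith_struct (n : nat) (H : multigraph n) := ArithStruct {
  arith_d : 'I_n -> nat;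
  arith_r : 'I_n -> nat;
  arith_r_gt0 : forall v, (0 < arith_r v)%N;
  arith_coprime : \big[gcdn/0%N]_(v < n) arith_r v = 1%N;
  arith_eq : forall v,
    (arith_r v * arith_d v = \sum_(u < n) H v u * arith_r u)%N
}.

Definition arith_mx (n : nat) (H : multigraph n) (S : arith_struct H) :
    'M[int]_n :=
  diag_mx (\row_v (arith_d S v)%:Z) - map_mx Posz H.

Section Cokernel.
Variables (m n : nat) (M : 'M[int]_(m, n)).

Definition im_mx : {pred 'cV[int]_m} :=
  [pred y | `[< exists x : 'cV[int]_n, y = M *m x >]].

Fact im_mx_zmod_closed : zmod_closed im_mx.
Proof.
split=> [|_ _ /asboolP[x ->] /asboolP[y ->]]; apply/asboolP.
  by exists 0; rewrite mulmx0.
by exists (x - y); rewrite mulmxBr.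
Qed.

HB.instance Definition _ :=
  GRing.isZmodClosed.Build 'cV[int]_m im_mx im_mx_zmod_closed.

End Cokernel.

Definition coker_mx (m n : nat) (M : 'M[int]_(m, n)) : zmodType :=
  Quotient.quot (im_mx M).

Section Torsion.
Variable V : zmodType.

Definition is_torsion : {pred V} :=
  [pred x | `[< exists2 k : nat, (0 < k)%N & x *+ k = 0 >]].

Fact is_torsion_zmod_closed : zmod_closed is_torsion.
Proof.
split=> [|x y /asboolP[k k0 xk] /asboolP[l l0 yl]]; apply/asboolP.
  by exists 1%N.
exists (k * l)%N; first by rewrite muln_gt0 k0.
by rewrite mulrnBl mulrnA xk mul0rn mulnC mulrnA yl mul0rn subrr.
Qed.

HB.instance Definition _ :=
  GRing.isZmodClosed.Build V is_torsion is_torsion_zmod_closed.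

Record torsion := Torsion { torsion_val :> V; _ : torsion_val \in is_torsion }.

HB.instance Definition _ := [isSub for torsion_val].
HB.instance Definition _ := [Choice of torsion by <:].
HB.instance Definition _ := [SubChoice_isSubZmodule of torsion by <:].

End Torsion.

Definition critical_group (n : nat) (H : multigraph n) (S : arith_struct H) :
    zmodType :=
  torsion (coker_mx (arith_mx S)).

Section CompleteGraph.
Variable n : nat.

Definition complete_adj : 'M[nat]_n := \matrix_(u, v) (u != v : nat).

Fact complete_adj_sym u v : complete_adj u v = complete_adj v u.
Proof. by rewrite !mxE eq_sym. Qed.

Fact complete_adj_loopless v : complete_adj v v = 0%N.
Proof. by rewrite mxE eqxx. Qed.

Fact complete_adj_connected u v :
  connect (fun x y => (0 < complete_adj x y)%N) u v.
Proof.
have [->|uv] := eqVneq u v; first exact: connect0.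
by apply: connect1; rewrite mxE uv.
Qed.

Definition complete_graph : multigraph n :=
  Multigraph complete_adj_sym complete_adj_loopless complete_adj_connected.

End CompleteGraph.

(* Main.v *)
(* Take r = 1 and d = n - 1, so that the matrix is n I - J.  A vector with
   coordinate sum 0 whose coordinates are all divisible by n lies in the image
   of n I - J, and all the coordinates of a vector of the image are congruent
   modulo n; hence Z^(n-2) -> Z^n, which puts 0 in one extra coordinate and
   minus the sum in another, induces an embedding of (Z/n)^(n-2) in the
   critical group.  If #|G| divides n, the characters of G, read as
   homomorphisms to Z/n, embed G in a power of Z/n. *)
From HB Require Import structures.
Require Import Defs.
From mathcomp Require Import all_boot all_order all_algebra.
From mathcomp Require Import all_fingroup all_solvable all_field all_character.
From mathcomp Require Import boolp.

Set Implicit Arguments.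
Unset Strict Implicit.
Unset Printing Implicit Defensive.

Import GRing.Theory.
Local Open Scope ring_scope.

Lemma finZmod_mulrn_card (G : finZmodType) (x : G) : x *+ #|G| = 0.
Proof.
have /dvdnP[q Gq]: (#[x]%g %| #|G|)%N by rewrite -cardsT order_dvdG ?inE.
by rewrite Gq mulnC mulrnA -(FinRing.zmodXgE #[x]%g) expg_order mul0rn.
Qed.

(** Irreducible characters of an abelian group are linear, with values among the [n]-th roots of
    unity as [#|G|] divides [n]; [k i x] is the exponent of ['chi_i x] over a fixed primitive root,
    so it is additive only modulo [n]. The kernels of these characters meet trivially. *)
Lemma separating_characters (G : finZmodType) (n : nat) :
    (0 < n)%N -> (#|G| %| n)%N ->
  exists k : Iirr [set: G] -> G -> int,
    (forall i x y, (n %| k i (x - y) - (k i x - k i y))%Z) /\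
    (forall x, (forall i, (n %| k i x)%Z) -> x = 0).
Proof.
move=> n_gt0 /dvdnP[q nE].
have lin (i : Iirr [set: G]) : 'chi_i \is a linear_char.
  exact: char_abelianP (FinRing.Theory.zmod_abelian _) i.
have chi_n (i : Iirr [set: G]) x : 'chi_i x ^+ n = 1.
  have: 'chi_i x ^+ #[x]%g = 1 by rewrite lin_char_unity_root ?inE.
  have /dvdnP[p ->]: (#[x]%g %| n)%N.
    by rewrite nE dvdn_mull // -cardsT order_dvdG ?inE.
  by rewrite mulnC exprM => ->; rewrite expr1n.
have [z z_prim] := C_prim_root_exists n_gt0.
have /fin_all_exists[a aE] (i : Iirr [set: G]) :
    exists a : G -> nat, forall x, 'chi_i x = z ^+ a x.
  apply: (@fin_all_exists _ _ (fun x m => 'chi_i x = z ^+ m)) => x.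
  by have [j ->] := prim_rootP z_prim (chi_n i x); exists j.
exists (fun i x => a i x); split=> [i x y|x dvd_a].
  (* With [a i y] moved across, both sides are naturals, and congruence modulo [n] becomes equality
     of powers of [z]. *)
  rewrite opprB addrA -eqz_mod_dvd -PoszD.
  rewrite !modz_nat eqz_nat -(eq_prim_root_expr z_prim) exprD -!aE.
  by rewrite -lin_charM ?inE // FinRing.zmodMgE subrK.
suff: x \in \bigcap_(i : Iirr [set: G]) cfker 'chi_i.
  by rewrite TI_cfker_irr => /set1gP.
apply/bigcapP => i _.
rewrite cfkerEirr inE lin_char1 // aE -(expr0 z) (eq_prim_root_expr z_prim).
by rewrite mod0n; have := dvd_a i; rewrite dvdzE.
Qed.

(** Composing [phi] with the projection to the cokernel gives a true morphism; its values are
    torsion because [#|G|] kills [G]. *)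
Lemma critical_group_embedding (G : finZmodType) (n : nat) (H : multigraph n)
    (S : arith_struct H) (phi : G -> 'cV[int]_n) :
    (forall x y, phi (x - y) - (phi x - phi y) \in im_mx (arith_mx S)) ->
    (forall x, phi x \in im_mx (arith_mx S) -> x = 0) ->
  exists f : {additive G -> critical_group S}, injective f.
Proof.
move=> phiB phi_inj.
pose g x : coker_mx (arith_mx S) := \pi_(coker_mx (arith_mx S))%qT (phi x).
have gB : zmod_morphism g.
  move=> x y; rewrite /g -raddfB; apply/eqP.
  by rewrite -Quotient.idealrBE phiB.
pose gM := GRing.isZmodMorphism.Build _ _ g gB.
pose ga : {additive G -> coker_mx (arith_mx S)} := HB.pack g gM.
have g_tor x : g x \in @is_torsion (coker_mx (arith_mx S)).
  apply/asboolP; exists #|G|; first by apply/card_gt0P; exists x.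
  by rewrite -[g]/(ga : _ -> _) -raddfMn finZmod_mulrn_card raddf0.
pose f x : critical_group S := Torsion (g_tor x).
have fB : zmod_morphism f.
  by move=> x y; apply: val_inj; rewrite raddfB /= gB.
pose fM := GRing.isZmodMorphism.Build _ _ f fB.
pose fa : {additive G -> critical_group S} := HB.pack f fM.
exists fa => x y /= /(congr1 val) /= gxy.
apply/eqP; rewrite -subr_eq0; apply/eqP/phi_inj.
rewrite -[phi _]subr0 Quotient.idealrBE.
by apply/eqP; rewrite raddf0 -[LHS]/(g (x - y)) gB gxy subrr.
Qed.

Section CompleteGraphLaplacian.
Variables (n : nat) (n_gt0 : (0 < n)%N).

Fact complete_ones_coprime : \big[gcdn/0%N]_(v < n) 1%N = 1%N.
Proof. by case: n n_gt0 => // m _; rewrite big_ord_recl gcd1n. Qed.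

Fact complete_ones_eq (v : 'I_n) :
  (1 * n.-1 = \sum_(u < n) complete_graph n v u * 1)%N.
Proof.
rewrite mul1n (bigD1 v) //= mxE eqxx add0n.
rewrite (eq_bigr (fun=> 1%N)) => [|u uv]; last by rewrite mxE eq_sym uv.
by rewrite sum1_card cardC1 card_ord.
Qed.

Definition complete_laplacian : arith_struct (complete_graph n) :=
  @ArithStruct n (complete_graph n) (fun=> n.-1) (fun=> 1%N) (fun=> isT)
    complete_ones_coprime complete_ones_eq.

Lemma mul_complete_laplacian (x : 'cV[int]_n) i :
  (arith_mx complete_laplacian *m x) i 0 = n%:Z * x i 0 - \sum_j x j 0.
Proof.
rewrite mulmxBl mul_diag_mx !mxE (bigD1 i) //= [in RHS](bigD1 i) //=.
rewrite !mxE eqxx mul0r add0r opprD addrA; congr (_ - _).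
  have -> : n%:Z = n.-1%:Z + 1 by rewrite -PoszD addn1 prednK.
  by rewrite mulrDl mul1r addrK.
by apply: eq_bigr => j ji; rewrite !mxE eq_sym ji mul1r.
Qed.

Lemma im_complete_laplacian_eqmod (y : 'cV[int]_n) i j :
  y \in im_mx (arith_mx complete_laplacian) -> (n %| y i 0%R - y j 0%R)%Z.
Proof.
case/asboolP => x ->; rewrite !mul_complete_laplacian opprB addrA subrK.
by rewrite -mulrBr dvdz_mulr.
Qed.

(** A preimage is [y] divided by [n]: its coordinates again sum to 0, so only the multiplication by
    [n] acts on it. *)
Lemma mem_im_complete_laplacian (y : 'cV[int]_n) :
    \sum_i y i 0 = 0 -> (forall i, (n %| y i 0%R)%Z) ->
  y \in im_mx (arith_mx complete_laplacian).
Proof.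
move=> sum_y dvd_y; have nz : n%:Z != 0 by rewrite eqz_nat -lt0n.
apply/asboolP; exists (\col_i (y i 0%R %/ n)%Z); apply/colP => i.
rewrite mul_complete_laplacian mxE mulrC divzK //.
suff -> : \sum_j (\col_i (y i 0%R %/ n)%Z) j 0 = 0 by rewrite subr0.
apply: (mulIf nz); rewrite mul0r mulr_suml -[RHS]sum_y.
by apply: eq_bigr => j _; rewrite mxE divzK.
Qed.

End CompleteGraphLaplacian.

Definition balance (n : nat) (l : 'I_n) (b : 'cV[int]_n) : 'cV[int]_n :=
  b - (\sum_i b i 0) *: delta_mx l 0.

Lemma balanceB (n : nat) (l : 'I_n) : {morph balance l : x y / x - y}.
Proof.
move=> x y; rewrite /balance; under eq_bigr do rewrite !mxE.
by rewrite sumrB scalerBl !opprD addrACA.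
Qed.

Lemma sum_balance (n : nat) (l : 'I_n) (b : 'cV[int]_n) :
  \sum_i balance l b i 0 = 0.
Proof.
under eq_bigr do rewrite !mxE; rewrite sumrB -mulr_sumr.
rewrite [X in _ * X](bigD1 l) //= [X in _ * (_ + X)]big1 => [|i /negPf il].
  by rewrite !eqxx /= addr0 mulr1 subrr.
by rewrite il.
Qed.

Lemma dvdz_balance (n : nat) (l : 'I_n) (d : int) (b : 'cV[int]_n) i :
  (forall j, (d %| b j 0%R)%Z) -> (d %| balance l b i 0%R)%Z.
Proof.
move=> db; rewrite !mxE; apply: rpredB => //.
by rewrite dvdz_mulr //; apply: rpred_sum => j _; apply: db.
Qed.

Lemma balance_id (n : nat) (l : 'I_n) (b : 'cV[int]_n) i :
  i != l -> balance l b i 0 = b i 0.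
Proof. by move=> /negPf il; rewrite !mxE il mulr0 subr0. Qed.

Theorem proposition21 (G : finZmodType) :
  exists (n : nat) (S : arith_struct (complete_graph n))
         (f : {additive G -> critical_group S}),
    injective f.
Proof.
(* A multiple of [#|G|] with room for [N] character coordinates and two more. *)
pose N := Nirr [set: G]; pose n := (#|G| * N.+2)%N.
have G_gt0 : (0 < #|G|)%N by apply/card_gt0P; exists 0.
have leNn : (N.+2 <= n)%N by rewrite leq_pmull.
have n_gt0 : (0 < n)%N by apply: leq_trans leNn.
have [k [kB k_inj]] := separating_characters n_gt0 (dvdn_mulr _ (dvdnn _)).
exists n, (complete_laplacian n_gt0).
(* Indices from [N] on get the default 0, among them [c], of value [N], and [l], of value [N.+1]. *)
pose b x : 'cV[int]_n := \col_i oapp (k^~ x) 0 (insub (i : nat)).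
pose l := Ordinal leNn; pose c : 'I_n := Ordinal (ltnW leNn).
apply: (@critical_group_embedding _ _ _ _ (balance l \o b)) => [x y|x bx_im] /=.
  rewrite -!balanceB; apply: mem_im_complete_laplacian (sum_balance _ _) _ => i.
  apply: dvdz_balance => j; rewrite !mxE.
  by case: insub => [v|] /=; [apply: kB | rewrite !subr0 dvdz0].
(* Coordinate [v] is congruent modulo [n] to coordinate [c], which is 0; balancing changes neither,
   as both differ from [l]. *)
apply: k_inj => v; pose i := widen_ord (ltnW (ltnW leNn)) v.
have := im_complete_laplacian_eqmod i c bx_im.
rewrite !balance_id -?val_eqE /= ?(ltn_eqF (leqW (ltn_ord v))) ?ltn_eqF //.
by rewrite !mxE valK insubN ?ltnn //= subr0.
Qed.
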